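(* Let $\mathbb{K}$ be an algebraically closed field of characteristic zero, $\mathcal{C}\subset\mathbb{K}^2$ an affine irreducible plane curve, $A=(a,b)\in\mathbb{K}^2$, $d\in\mathbb{K}\setminus\{0\}$, and assume that $\mathcal{C}_0\neq\emptyset$ and that $\mathcal{C}$ is not a circle centered at $A$. Then an irreducible component $\mathcal{M}$ of $\mathfrak{C}(\mathcal{C},A,d)$ is special if and only if $\mathfrak{C}(\mathcal{M},A,d)=\mathcal{C}$.
   Context: For an irreducible plane curve $\mathcal{D}$ defined by an irreducible polynomial $g(y_1,y_2)$, and $\delta\in\mathbb{K}\setminus\{0\}$: $\mathfrak{B}(\mathcal{D},A,\delta)\subset\mathbb{K}^2\times\mathbb{K}^2\times\mathbb{K}$ is the set of $(\bar x,\bar y,w)$ with $g(y_1,y_2)=0$, $(x_1-y_1)^2+(x_2-y_2)^2=\delta^2$, $(y_2-b)(x_1-y_1)-(y_1-a)(x_2-y_2)=0$, $w((y_1-a)^2+(y_2-b)^2)=1$; $\pi_1,\pi_2$ denote the projections $(\bar x,\bar y,w)\mapsto\bar x$ and $(\bar x,\bar y,w)\mapsto\bar y$ on $\mathfrak{B}(\mathcal{D},A,\delta)$, and the conchoid $\mathfrak{C}(\mathcal{D},A,\delta)$ is the Zariski closure of $\pi_1(\mathfrak{B}(\mathcal{D},A,\delta))$. $\mathcal{D}_0=\{(p_1,p_2)\in\mathcal{D}:(p_1-a)^2+(p_2-b)^2\neq0\}$. An irreducible component $\mathcal{M}$ of $\mathfrak{C}(\mathcal{C},A,d)$ is called simple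 if there is a non-empty Zariski dense subset $\Omega\subset\mathcal{M}$ such that $\mathrm{Card}(\pi_2(\pi_1^{-1}(Q)))=1$ for all $Q\in\Omega$ (projections associated with $\mathfrak{B}(\mathcal{C},A,d)$); otherwise it is called special. A circle centered at $A$ of radius $r$ is $(y_1-a)^2+(y_2-b)^2=r^2$. *)

(* Defs.v *)
From HB Require Import structures.
From mathcomp Require Import all_boot all_order all_algebra.
From mathcomp Require Import mpoly.
Set Implicit Arguments. Unset Strict Implicit. Unset Printing Implicit Defensive.
Import GRing.Theory.
Local Open Scope ring_scope.

Section Conchoid.
Variable K : closedFieldType.

Definition pt := (K * K)%type.
Definition pset := pt -> Prop.

Definition ev (p : {mpoly K[2]}) (y : pt) : K :=
  p.@[fun i : 'I_2 => if val i == 0%N then y.1 else y.2].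

Definition zeroset (g : {mpoly K[2]}) : pset := fun y => ev g y = 0.

(* irreducible polynomial of K[y1,y2]: non-constant, and any factorization
   has a constant (= unit, since K[y1,y2] is a domain) factor *)
Definition mirreducible (g : {mpoly K[2]}) : Prop :=
  (1 < msize g)%N /\
  forall p q : {mpoly K[2]}, g = p * q -> (msize p <= 1)%N \/ (msize q <= 1)%N.

Definition seteq (S T : pset) := forall y, S y <-> T y.
Definition subset (S T : pset) := forall y, S y -> T y.

Definition zclosure (S : pset) : pset :=
  fun x => forall p : {mpoly K[2]}, (forall y, S y -> ev p y = 0) -> ev p x = 0.

Definition zclosed (S : pset) := subset (zclosure S) S.

Definition zirreducible (M : pset) : Prop :=
  zclosed M /\ (exists y, M y) /\
  forall S1 S2 : pset, zclosed S1 -> zclosed S2 ->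
    subset M (fun y => S1 y \/ S2 y) -> subset M S1 \/ subset M S2.

Definition irr_component (M X : pset) : Prop :=
  zirreducible M /\ subset M X /\
  forall N : pset, zirreducible N -> subset M N -> subset N X -> seteq N M.

Definition sqdist (A y : pt) : K := (y.1 - A.1) ^+ 2 + (y.2 - A.2) ^+ 2.

(* the incidence variety B(D,A,delta), for D a subset of K^2
   (for D = V(g) the condition "y in D" is exactly g(y1,y2) = 0) *)
Definition Bset (D : pset) (A : pt) (delta : K) (x y : pt) (w : K) : Prop :=
  D y /\
  (x.1 - y.1) ^+ 2 + (x.2 - y.2) ^+ 2 = delta ^+ 2 /\
  (y.2 - A.2) * (x.1 - y.1) - (y.1 - A.1) * (x.2 - y.2) = 0 /\
  w * sqdist A y = 1.

Definition conchoid (D : pset) (A : pt) (delta : K) : pset :=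
  zclosure (fun x => exists y w, Bset D A delta x y w).

Definition D0 (D : pset) (A : pt) : pset := fun p => D p /\ sqdist A p != 0.

Definition circle (A : pt) (r : K) : pset := fun y => sqdist A y = r ^+ 2.

Definition fibre2 (C : pset) (A : pt) (d : K) (Q : pt) : pset :=
  fun y => exists w, Bset C A d Q y w.

Definition simple_comp (C : pset) (A : pt) (d : K) (M : pset) : Prop :=
  exists Omega : pset,
    subset Omega M /\ (exists Q, Omega Q) /\ seteq (zclosure Omega) M /\
    forall Q, Omega Q ->
      exists y, fibre2 C A d Q y /\ forall y', fibre2 C A d Q y' -> y' = y.

Definition special_comp (C : pset) (A : pt) (d : K) (M : pset) : Prop :=
  ~ simple_comp C A d M.

End Conchoid.

(* Main.v *)
Require Import Defs.
From Stdlib Require Import Classical.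
From HB Require Import structures.
From mathcomp Require Import all_boot all_order all_algebra.
From mathcomp Require Import mpoly ring.
Set Implicit Arguments. Unset Strict Implicit. Unset Printing Implicit Defensive.
Import GRing.Theory.
Local Open Scope ring_scope.

(* Write q(y) = (y - A).(y - A). A point x of the conchoid over y in C is
   x = y + (d/s)(y - A) with s^2 = q(y), and then q(x) = (s + d)^2, so that y is
   recovered from x by the same formula with s replaced by -(s + d).
   The conchoid is thus dominated by the double cover s^2 = q of C, which is
   irreducible or, when q is a square in the function field of C, splits into
   two branches; each component M of the conchoid is the closure of a branch,
   so M dominates C and M has a dense set of points with a nonempty fibre.
   The fibre over x consists of those of the two points x +- (d/r)(x - A),
   r^2 = q(x), that lie in C. If a dense set of points of M has both of them in
   C, then so have all points of M, because g(x + (d/r)(x - A)) is, up to a power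
   of r, of the form E(x) + r O(x), and E = O = 0 on M; hence the conchoid of M is
   C. Conversely, if the conchoid of M is C, a one-point fibre forces q = 0 or
   q = d^2; were this to hold on a dense set of M, then C would lie in the zero
   set of q (q - 4 d^2), which is excluded. *)

(** * Plane curves: primality and infinitude of the zero set *)

Section Bivariate.
Variable K : closedFieldType.
Implicit Types (p q r : {poly {poly K}}) (f : {mpoly K[2]}) (y : pt K).

Lemma mpoly2_ind (P : {mpoly K[2]} -> Prop) :
    (forall c, P c%:MP) -> (forall i, P 'X_i) ->
    (forall f1 f2, P f1 -> P f2 -> P (f1 + f2)) ->
    (forall f1 f2, P f1 -> P f2 -> P (f1 * f2)) ->
  forall f, P f.
Proof.
move=> PC PX PD PM; elim/mpolyind => [|c m f _ _ Pf]; first exact: PC 0.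
apply: (PD) => //; rewrite -mul_mpolyC; apply: (PM) => //.
rewrite mpolyXE_id; elim/big_ind: _ => [|f1 f2|i _]; [exact: (PC 1)|exact: PM|].
by elim: (m i) => [|n IH]; [exact: (PC 1) | rewrite exprS; apply: (PM)].
Qed.

(** * The isomorphism between K[y1,y2] and K[y1][y2] *)

Definition ev2 p y : K := p.[y.2%:P].[y.1].

Lemma ev2D p q y : ev2 (p + q) y = ev2 p y + ev2 q y.
Proof. by rewrite /ev2 !hornerD. Qed.

Lemma ev2M p q y : ev2 (p * q) y = ev2 p y * ev2 q y.
Proof. by rewrite /ev2 !hornerM. Qed.

Lemma ev2C (c : {poly K}) y : ev2 c%:P y = c.[y.1].
Proof. by rewrite /ev2 hornerC. Qed.

(** With [y2] as the outer variable, resultants and pseudo-division in [y2] become available. The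
    inverse is [mp] below. *)
Definition bip : {rmorphism {mpoly K[2]} -> {poly {poly K}}} :=
  mmap (polyC \o polyC) (fun i : 'I_2 => if val i == 0%N then 'X%:P else 'X).

Definition mp_inner : {rmorphism {poly K} -> {mpoly K[2]}} :=
  @horner_morph _ _ (@mpolyC 2 K) 'X_(0 : 'I_2) (fun c => mulrC _ _).

Definition mp : {rmorphism {poly {poly K}} -> {mpoly K[2]}} :=
  @horner_morph _ _ mp_inner 'X_(1 : 'I_2) (fun c => mulrC _ _).

Lemma mp_innerC c : mp_inner c%:P = c%:MP.
Proof. exact: horner_morphC. Qed.

Lemma mp_innerX : mp_inner 'X = 'X_(0 : 'I_2).
Proof. exact: horner_morphX. Qed.

Lemma mpC c : mp c%:P = mp_inner c.
Proof. exact: horner_morphC. Qed.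

Lemma mpX : mp 'X = 'X_(1 : 'I_2).
Proof. exact: horner_morphX. Qed.

Lemma evD f1 f2 y : ev (f1 + f2) y = ev f1 y + ev f2 y.
Proof. by rewrite /ev mevalD. Qed.

Lemma evB f1 f2 y : ev (f1 - f2) y = ev f1 y - ev f2 y.
Proof. by rewrite /ev mevalB. Qed.

Lemma evM f1 f2 y : ev (f1 * f2) y = ev f1 y * ev f2 y.
Proof. by rewrite /ev mevalM. Qed.

Lemma evC c y : ev c%:MP y = c.
Proof. by rewrite /ev mevalC. Qed.

Lemma evX i y : ev 'X_i y = if val i == 0%N then y.1 else y.2.
Proof. by rewrite /ev mevalXU. Qed.

Lemma bipC c : bip c%:MP = c%:P%:P.
Proof. by rewrite /= mmapC. Qed.

Lemma bipX i : bip 'X_i = if val i == 0%N then 'X%:P else 'X.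
Proof. by rewrite /= mmapX mmap1U. Qed.

Lemma ev2_bip f y : ev2 (bip f) y = ev f y.
Proof.
elim/mpoly2_ind: f => [c|i|f1 f2 IH1 IH2|f1 f2 IH1 IH2].
- by rewrite bipC ev2C hornerC evC.
- by rewrite bipX evX; case: ifP => _; rewrite /ev2 !(hornerC, hornerX).
- by rewrite rmorphD ev2D evD IH1 IH2.
- by rewrite rmorphM ev2M evM IH1 IH2.
Qed.

Lemma bipK : cancel bip mp.
Proof.
elim/mpoly2_ind => [c|i|f1 f2 IH1 IH2|f1 f2 IH1 IH2].
- by rewrite bipC mpC mp_innerC.
- rewrite bipX; case: ifP => i0; rewrite ?mpC ?mp_innerX ?mpX.
    by congr ('X_ _); apply/val_inj; rewrite (eqP i0).
  by congr ('X_ _); apply/val_inj; case: i i0 => [[|[|]]].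
- by rewrite !rmorphD IH1 IH2.
- by rewrite !rmorphM IH1 IH2.
Qed.

Lemma mpK : cancel mp bip.
Proof.
have bip_inner (c : {poly K}) : bip (mp_inner c) = c%:P.
  elim/poly_ind: c => [|c a IH]; first by rewrite !rmorph0.
  by rewrite !rmorphD !rmorphM IH mp_innerX mp_innerC bipX bipC.
elim/poly_ind => [|p c IH]; first by rewrite !rmorph0.
by rewrite !rmorphD !rmorphM IH mpX mpC bip_inner bipX.
Qed.

Lemma bip_const f : (msize f <= 1)%N -> exists c : K, bip f = c%:P%:P.
Proof. by move/msize1_polyC => ->; eexists; exact: bipC. Qed.

(** * Factorization and divisibility in K[y1][y2] *)

Definition birr p :=
  (forall c : K, p <> c%:P%:P) /\
  forall q r, p = q * r ->
    (exists c : K, q = c%:P%:P) \/ (exists c : K, r = c%:P%:P).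

Lemma birr_bip f : mirreducible f -> birr (bip f).
Proof.
case=> f_gt1 f_irr; split=> [c Df|q r Df].
  have: f = c%:MP by rewrite -[f]bipK Df mpC mp_innerC.
  by move=> Ef; rewrite Ef msizeC in f_gt1; case: (c != 0) f_gt1.
have: f = mp q * mp r by rewrite -[f]bipK Df rmorphM.
by case/f_irr => /bip_const; rewrite mpK => ?; [left|right].
Qed.

Lemma dvd_XsubC p (a : K) :
  map_poly (horner_eval a) p = 0 -> exists p', p = ('X - a%:P)%:P * p'.
Proof.
move=> p0; exists (map_poly (fun c => c %/ ('X - a%:P)) p).
apply/polyP=> i; rewrite coefCM coef_map_id0 ?div0p //.
have /rootP : (p`_i).[a] = 0.
  by move/polyP/(_ i): p0; rewrite coef_map coef0.
by rewrite -dvdp_XsubCl => /divpK; rewrite mulrC.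
Qed.

(** The element [X - a] is prime in K[y1][y2], since substituting [a] for [y1] lands in the domain
    K[y2] and has only its multiples as kernel. *)
Lemma map_horner_prod p q (a : K) : map_poly (horner_eval a) (p * q) = 0 ->
  (exists p', p = ('X - a%:P)%:P * p') \/ (exists q', q = ('X - a%:P)%:P * q').
Proof.
by rewrite rmorphM => /eqP; rewrite mulf_eq0 => /orP[] /eqP /dvd_XsubC; [left|right].
Qed.

(* Gauss's lemma: over an algebraically closed field the content [c] can be
   removed one linear factor at a time. *)
Lemma gauss (c : {poly K}) p q r : c != 0 -> c%:P * p = q * r ->
  exists q' r' (e : {poly K}), p = q' * r' /\ q = e%:P * q'.
Proof.
elim: {c}(size c) {-2}c (leqnn (size c)) q r => [|n IH] c sz_c q r c0 Ecp.
  by move: c0; rewrite -size_poly_gt0; case: (size c) sz_c.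
have [/size_poly1P[k k0 Dc]|] := boolP (size c == 1).
  exists q, (k^-1%:P%:P * r), 1; rewrite mul1r; split=> //.
  by rewrite mulrCA -Ecp Dc mulrA -!polyCM mulVf ?mul1r.
case/closed_rootP=> a; rewrite -dvdp_XsubCl => /dvdpP[c' Dc].
have c'0 : c' != 0 by apply: contraNneq c0 => c'0; rewrite Dc c'0 mul0r.
have sz_c' : (size c' <= n)%N.
  by move: sz_c; rewrite Dc size_Mmonic ?monicXsubC // size_XsubC addn2.
have X0 : ('X - a%:P)%:P != 0 :> {poly {poly K}} by rewrite polyC_eq0 polyXsubC_eq0.
have: map_poly (horner_eval a) (q * r) = 0.
  rewrite -Ecp rmorphM /= map_polyC /= /horner_eval Dc hornerM.
  by rewrite hornerXsubC subrr mulr0 mul0r.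
case/map_horner_prod=> [[q1 Dq]|[r1 Dr]].
  have [|q' [r' [e [Dp Dq1]]]] := IH _ sz_c' q1 r c'0.
    by apply: (mulfI X0); rewrite mulrA -polyCM (mulrC _ c') -Dc Ecp Dq mulrA.
  by exists q', r', (('X - a%:P) * e); split; rewrite // Dq Dq1 mulrA polyCM.
apply: (IH _ sz_c' q r1 c'0); apply: (mulfI X0).
by rewrite mulrA -polyCM (mulrC _ c') -Dc Ecp Dr mulrCA.
Qed.

(** A nonzero resultant in [y2] supplies the Bezout identity. If it is zero, the gcd over the
    fraction field has positive degree in [y2], and Gauss's lemma turns pseudo-divisibility into
    divisibility. *)
Lemma birr_dvd_or_coprime p q : birr p -> (1 < size p)%N ->
  (exists r, q = p * r) \/
  exists (c : {poly K}) u v, c != 0 /\ c%:P = u * q + v * p.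
Proof.
move=> [_ p_irr] p_gt1.
have factor (q1 r1 : {poly {poly K}}) : p = q1 * r1 -> (1 < size q1)%N ->
    exists2 k : K, k != 0 & r1 = k%:P%:P.
  move=> Dp q1_gt1; case: (p_irr _ _ Dp) => [] [k Dk].
    by move: q1_gt1; rewrite Dk ltnNge size_polyC_leq1.
  exists k => //; apply: contraTneq p_gt1 => k0.
  by rewrite Dp Dk k0 !polyC0 mulr0 size_poly0.
have [q_le1|q_gt1] := leqP (size q) 1.
  rewrite (size1_polyC q_le1); have [->|c0] := eqVneq q`_0 0.
    by left; exists 0; rewrite mulr0.
  by right; exists q`_0, 1, 0; rewrite mul1r mul0r addr0.
have [|res0] := boolP (resultant q p == 0); last first.
  have [[u v] _ E] := resultant_in_ideal q_gt1 p_gt1.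
  by right; exists (resultant q p), u, v.
rewrite resultant_eq0; set r := gcdp q p => r_gt1; left.
have /Pdiv.Idomain.dvdpP[[c k] /= c0 Dp] : r %| p by apply: dvdp_gcdr.
have /Pdiv.Idomain.dvdpP[[c2 k2] /= c20 Dq] : r %| q by apply: dvdp_gcdl.
rewrite -mul_polyC mulrC in Dp; rewrite -mul_polyC mulrC in Dq.
rewrite mulrC [k * r]mulrC in Dp; rewrite mulrC [k2 * r]mulrC in Dq.
(* First use of Gauss: by irreducibility the gcd is [p] up to a constant and a content [e]. *)
have [r' [k' [e [Dp' Dr]]]] := gauss c0 Dp.
have r'_gt1 : (1 < size r')%N.
  rewrite ltnNge; apply: contraL r_gt1 => r'_le1.
  by rewrite -leqNgt Dr (size1_polyC r'_le1) -polyCM size_polyC_leq1.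
have [k0 k00 Dk'] := factor _ _ Dp' r'_gt1.
have Dr' : r' = k0^-1%:P%:P * p.
  by rewrite Dp' Dk' mulrCA -!polyCM mulVf ?mulr1.
have Dq1 : c2%:P * q = p * (k0^-1%:P%:P * e%:P * k2).
  by rewrite Dq Dr Dr'; ring.
(* Second use of Gauss: the multiplier [c2] is removed, and [e3] is constant by irreducibility, so
   [p] divides [q]. *)
have [q' [k3 [e3 [Dq' Dp3]]]] := gauss c20 Dq1.
have q'_gt1 : (1 < size q')%N.
  rewrite ltnNge; apply: contraL p_gt1 => q'_le1.
  by rewrite -leqNgt Dp3 (size1_polyC q'_le1) -polyCM size_polyC_leq1.
rewrite mulrC in Dp3; have [k4 k40 De3] := factor _ _ Dp3 q'_gt1.
exists (k4^-1%:P%:P * k3).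
by rewrite Dq' Dp3 De3 mulrA -(mulrA q') -!polyCM mulfV // mulr1.
Qed.

(** Without [y2], irreducibility over an algebraically closed field forces degree one: the curve is
    a vertical line. *)
Lemma birr_vertical p : birr p -> (size p <= 1)%N ->
  exists (a k : K), k != 0 /\ p = (k%:P * ('X - a%:P))%:P.
Proof.
move=> [p_nc p_irr] /size1_polyC Dp; set c := p`_0 in Dp.
have /closed_rootP[a] : size c != 1.
  by apply/negP => /size_poly1P[k _ Dc]; apply: (p_nc k); rewrite Dp Dc.
rewrite -dvdp_XsubCl => /dvdpP[c' Dc].
have [|[k Dk]|[k Dk]] := p_irr c'%:P ('X - a%:P)%:P; first by rewrite Dp Dc polyCM.
  exists a, k; move/polyC_inj: Dk => Dk; rewrite Dp Dc Dk; split=> //.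
  by apply/eqP => k0; apply: (p_nc 0); rewrite Dp Dc Dk k0 mul0r.
move/polyC_inj/(congr1 (fun q : {poly K} => size q)): Dk.
by rewrite size_XsubC size_polyC; case: (k != 0).
Qed.

Lemma root_above p (x : K) : (1 < size p)%N -> (lead_coef p).[x] != 0 ->
  exists z, ev2 p (x, z) = 0.
Proof.
move=> p_gt1 lcx; have sz := @size_map_poly_id0 _ _ (horner_eval x) p lcx.
have /closed_rootP[z /rootP z0] : size (map_poly (horner_eval x) p) != 1.
  by rewrite sz; case: (size p) p_gt1 => [|[]].
exists z; rewrite /ev2 /= -[RHS]z0 -{2}(hornerC z x) -/(horner_eval x z%:P).
by rewrite horner_map.
Qed.

(** If [g] divides neither factor, the Bezout identities give [c1], [c2] in K[y1]. Over an abscissa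
    where these and the leading coefficient of [g] are nonzero, the curve has a point, and neither
    factor vanishes there. A vertical line reduces to one variable. *)
Lemma zeroset_prime g f1 f2 : mirreducible g ->
  (forall y, zeroset g y -> ev f1 y * ev f2 y = 0) ->
  (forall y, zeroset g y -> ev f1 y = 0) \/ (forall y, zeroset g y -> ev f2 y = 0).
Proof.
move=> /birr_bip g_irr f12.
have dvd f r : bip f = bip g * r -> forall y, zeroset g y -> ev f y = 0.
  by move=> Df y gy; rewrite -ev2_bip Df ev2M ev2_bip gy mul0r.
have [g_le1|g_gt1] := leqP (size (bip g)) 1.
  have [a [k [k0 Dg]]] := birr_vertical g_irr g_le1.
  have gE y : zeroset g y <-> y.1 = a.
    rewrite /zeroset -ev2_bip Dg ev2C hornerM hornerC hornerXsubC.
    split=> [/eqP|->]; last by rewrite subrr mulr0.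
    by rewrite mulf_eq0 (negPf k0) subr_eq0 => /eqP.
  pose r f : {poly K} := map_poly (horner_eval a) (bip f).
  have rE f z : (r f).[z] = ev f (a, z).
    rewrite -ev2_bip /ev2 /= -{1}(hornerC z a) -/(horner_eval a z%:P).
    by rewrite /r horner_map.
  have [/eqP|] := boolP (r f1 * r f2 == 0).
    move/eqP; rewrite mulf_eq0 => /orP[] /eqP r0; [left|right];
      by case=> x z /gE /= ->; rewrite -rE r0 horner0.
  case/closed_nonrootP=> z /negP[]; apply/rootP; rewrite hornerM !rE.
  by apply: f12; apply/gE.
have [[r /dvd]|[c1 [u1 [v1 [c10 E1]]]]] := birr_dvd_or_coprime (bip f1) g_irr g_gt1.
  by left.
have [[r /dvd]|[c2 [u2 [v2 [c20 E2]]]]] := birr_dvd_or_coprime (bip f2) g_irr g_gt1.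
  by right.
have: c1 * c2 * lead_coef (bip g) != 0.
  by rewrite !mulf_neq0 // lead_coef_eq0 -size_poly_gt0 ltnW.
case/closed_nonrootP=> x; rewrite /root !hornerM !mulf_eq0 !negb_or.
case/andP=> /andP[c1x c2x] lcx; have [z gz] := root_above g_gt1 lcx.
have := f12 (x, z); rewrite /zeroset -!ev2_bip => /(_ gz) /eqP.
rewrite mulf_eq0 => /orP[] /eqP fz.
  by case/eqP: c1x; rewrite -[LHS](ev2C _ (x, z)) E1 ev2D !ev2M fz gz !mulr0 addr0.
by case/eqP: c2x; rewrite -[LHS](ev2C _ (x, z)) E2 ev2D !ev2M fz gz !mulr0 addr0.
Qed.

Lemma avoid (s : seq K) (c : {poly K}) : c != 0 -> exists2 x, x \notin s & c.[x] != 0.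
Proof.
move=> c0; have: c * \prod_(a <- s) ('X - a%:P) != 0.
  by rewrite mulf_neq0 // monic_neq0 // monic_prod_XsubC.
case/closed_nonrootP=> x; rewrite rootM negb_or root_prod_XsubC.
by case/andP; exists x.
Qed.

Lemma zeroset_infinite g (s : seq (pt K)) : mirreducible g ->
  exists2 y, zeroset g y & y \notin s.
Proof.
move=> /birr_bip g_irr.
have [g_le1|g_gt1] := leqP (size (bip g)) 1.
  have [a [k [k0 Dg]]] := birr_vertical g_irr g_le1.
  have [z zs _] := avoid (map snd s) (oner_neq0 _).
  exists (a, z); last by apply: contra zs => azs; apply/mapP; exists (a, z).
  by rewrite /zeroset -ev2_bip Dg ev2C hornerM hornerXsubC subrr mulr0.
have lc0 : lead_coef (bip g) != 0 by rewrite lead_coef_eq0 -size_poly_gt0 ltnW.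
have [x xs lcx] := avoid (map fst s) lc0.
have [z gz] := root_above g_gt1 lcx.
exists (x, z); first by rewrite /zeroset -ev2_bip.
by apply: contra xs => xzs; apply/mapP; exists (x, z).
Qed.

Lemma sqr_ex (c : K) : exists s, s ^+ 2 = c.
Proof.
have /closed_rootP[s] : size ('X^2 - c%:P) != 1 by rewrite size_XnsubC.
by rewrite /root hornerD hornerN hornerXn hornerC subr_eq0 => /eqP; exists s.
Qed.

Lemma two_neq0 : [pchar K] =i pred0 -> 2%:R != 0 :> K.
Proof. by move/pcharf0P ->. Qed.

(* [m |-> (x, y)] with [x + i y = r m] and [x - i y = r / m] parametrizes the
   circle of radius [r], so it pulls polynomials back to Laurent polynomials. *)
Lemma zeroset_sub_circle g A (r : K) : [pchar K] =i pred0 -> mirreducible g ->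
  r != 0 -> Defs.subset (zeroset g) (circle A r) -> seteq (zeroset g) (circle A r).
Proof.
move=> char0 g_irr r0 gr y; split=> [/gr //|yr].
have two0 := two_neq0 char0; have [i i2] := sqr_ex (- 1).
have i0 : i != 0 by apply: contra_eq_neq i2 => ->; rewrite expr0n eq_sym oppr_eq0 oner_neq0.
pose c m : pt K := (A.1 + r * (m + m^-1) / 2%:R, A.2 + r * (m - m^-1) / (2%:R * i)).
have cP z : circle A r z -> exists2 m, m != 0 & z = c m.
  rewrite /circle /sqdist => zr; pose m := ((z.1 - A.1) + i * (z.2 - A.2)) / r.
  have mV : m * (((z.1 - A.1) - i * (z.2 - A.2)) / r) = 1.
    rewrite /m mulf_div [_ * (_ - _)]mulrC -subr_sqr exprMn i2 mulN1r opprK zr -expr2.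
    by rewrite divff // expf_neq0.
  have m0 : m != 0 by apply: contra_eq_neq mV => ->; rewrite mul0r eq_sym oner_neq0.
  have mVE : m^-1 = ((z.1 - A.1) - i * (z.2 - A.2)) / r.
    by apply: (mulfI m0); rewrite mulfV // mV.
  exists m => //; rewrite [LHS]surjective_pairing /c mVE /m.
  by congr (_, _); field; rewrite ?r0 ?i0 ?two0.
have [N [L LE]] : exists N (L : {poly K}), forall m, m != 0 -> m ^+ N * ev g (c m) = L.[m].
  elim/mpoly2_ind: (g) => [k|j|f1 f2 [N1 [L1 E1]] [N2 [L2 E2]]|f1 f2 [N1 [L1 E1]] [N2 [L2 E2]]].
  - by exists 0%N, k%:P => m _; rewrite evC hornerC mul1r.
  - exists 1%N, (if val j == 0%N then A.1 *: 'X + (r / 2%:R) *: ('X ^+ 2 + 1)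
      else A.2 *: 'X + (r / (2%:R * i)) *: ('X ^+ 2 - 1)) => m m0.
    by rewrite evX; case: ifP => _; rewrite /c !hornerE /=; field; rewrite ?m0 ?i0 ?two0.
  - exists (N1 + N2)%N, ('X ^+ N2 * L1 + 'X ^+ N1 * L2) => m m0.
    by rewrite evD !hornerE -E1 // -E2 // exprD; ring.
  - exists (N1 + N2)%N, (L1 * L2) => m m0.
    by rewrite evM hornerM -E1 // -E2 // exprD; ring.
(* If L = 0, [g] vanishes on the whole circle. Otherwise the curve lies in the image of the finitely
   many roots of L, which contradicts its infinitude. *)
have [L0|L0] := eqVneq L 0.
  have [m m0 ->] := cP _ yr; apply/eqP; rewrite /zeroset.
  have := LE m m0; rewrite L0 horner0 => /eqP.
  by rewrite mulf_eq0 expf_eq0 (negPf m0) andbF.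
have [rs DL] := closed_field_poly_normal L.
have [z gz /negP[]] := zeroset_infinite (map c rs) g_irr.
have [m m0 Dz] := cP _ (gr z gz); apply/mapP; exists m => //.
have := LE m m0; rewrite -Dz gz mulr0 => /esym/eqP.
by rewrite DL hornerZ mulf_eq0 lead_coef_eq0 (negPf L0) -/(root _ _) root_prod_XsubC.
Qed.
End Bivariate.

(** * Points at a given distance on lines through [A] *)

Section Conchoids.
Variable K : closedFieldType.
Hypothesis char0 : [pchar K] =i pred0.
Implicit Types (A x y : pt K) (f p : {mpoly K[2]}) (D S T M : pset K).

Lemma not_all_imp (T : Type) (P R : T -> Prop) :
  ~ (forall z, P z -> R z) -> exists z, P z /\ ~ R z.
Proof.
move=> nPR; have [z nz] := not_all_ex_not _ _ nPR.
by exists z; apply: imply_to_and.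
Qed.

Lemma sub_zclosure S : Defs.subset S (zclosure S).
Proof. by move=> x Sx p; apply. Qed.

Lemma zclosure_sub S T : Defs.subset S (zclosure T) -> Defs.subset (zclosure S) (zclosure T).
Proof. by move=> ST x Sx p Tp; apply: Sx => y /ST; apply. Qed.

Lemma zclosed_zclosure S : zclosed (zclosure S).
Proof. by apply: zclosure_sub => x. Qed.

(** If [p'] vanishes on S but not at [x], then multiplying by [p'] turns any [p] vanishing on T into
    one vanishing on the union. *)
Lemma zclosureU S T x : zclosure (fun y => S y \/ T y) x -> zclosure S x \/ zclosure T x.
Proof.
move=> STx; have [|NSx] := classic (zclosure S x); [by left | right=> p Tp].
have [p' [Sp' /eqP p'x]] := not_all_imp NSx.
apply/eqP; have : ev (p' * p) x = 0.
  by apply: STx => y; rewrite evM => -[/Sp'->|/Tp->]; rewrite ?mul0r ?mulr0.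
by move/eqP; rewrite evM mulf_eq0 (negPf p'x).
Qed.

(* The points [mv A (d / s) y] with [s ^+ 2 = sqdist A y] are the points at
   distance [d] from [y] on the line [A y]. *)
Definition mv A (t : K) y : pt K := (y.1 + t * (y.1 - A.1), y.2 + t * (y.2 - A.2)).

Lemma fibre2P D A d x y : d != 0 -> fibre2 D A d x y <->
  D y /\ exists s, [/\ s != 0, s ^+ 2 = sqdist A y & x = mv A (d / s) y].
Proof.
move=> d0; split=> [[w [Dy [xyd [par wq]]]]|[Dy [s [s0 s2 ->]]]]; last first.
  exists (s ^- 2); split=> //; rewrite -s2 mulVf ?expf_neq0 // /mv /=; split.
    suff -> : d ^+ 2 = (d / s) ^+ 2 * sqdist A y by rewrite /sqdist; ring.
    by rewrite -s2; field.
  by split=> //; ring.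
split=> //; have q0 : sqdist A y != 0.
  by apply: contra_eq_neq wq => ->; rewrite mulr0 eq_sym oner_neq0.
case: x y xyd par q0 {wq Dy} => [x1 x2] [y1 y2]; rewrite /sqdist /mv /= => xyd par q0.
set q := _ + _ in q0 *.
(* The coefficient of the orthogonal projection of [x - y] on [y - A]; by parallelism x - y = t (y -
   A), and then s = d / t. *)
pose t := ((y1 - A.1) * (x1 - y1) + (y2 - A.2) * (x2 - y2)) / q.
have t1 : x1 - y1 = t * (y1 - A.1).
  apply: (mulIf q0); rewrite mulrAC /t divfK // /q; apply/eqP; rewrite -subr_eq0; apply/eqP.
  transitivity ((y2 - A.2) * ((y2 - A.2) * (x1 - y1) - (y1 - A.1) * (x2 - y2))); first by ring.
  by rewrite par mulr0.
have t2 : x2 - y2 = t * (y2 - A.2).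
  apply: (mulIf q0); rewrite mulrAC /t divfK // /q; apply/eqP; rewrite -subr_eq0; apply/eqP.
  transitivity (- (y1 - A.1) * ((y2 - A.2) * (x1 - y1) - (y1 - A.1) * (x2 - y2))); first by ring.
  by rewrite par mulr0.
have tq : t ^+ 2 * q = d ^+ 2 by rewrite -xyd t1 t2 /q; ring.
have t0 : t != 0.
  apply: contra_eq_neq tq => ->; rewrite expr0n mul0r eq_sym; exact: expf_neq0.
exists (d / t); split; first by rewrite mulf_neq0 ?invr_eq0.
  by rewrite expr_div_n -tq mulrC mulKf // expf_neq0.
by rewrite invf_div mulrCA mulfV // mulr1 -t1 -t2 !(addrC y1, addrC y2) !subrK.
Qed.

Lemma sqdist_mv A d s y : s != 0 -> s ^+ 2 = sqdist A y ->
  sqdist A (mv A (d / s) y) = (s + d) ^+ 2.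
Proof.
move=> s0 s2; have -> : sqdist A (mv A (d / s) y) = (1 + d / s) ^+ 2 * sqdist A y.
  by rewrite /sqdist /mv /=; ring.
by rewrite -s2; field.
Qed.

(** The factors 1 + d/s and 1 - d/(s + d) are inverse to each other. In the excluded case s + d = 0
    the moved point is [A] itself. *)
Lemma mvK A d s y : s != 0 -> s + d != 0 -> mv A (d / - (s + d)) (mv A (d / s) y) = y.
Proof.
by case: y => y1 y2 s0 r0; rewrite /mv /=; congr (_, _); field; rewrite s0 oppr_eq0.
Qed.

Lemma sqdist_polyP A : exists Q : {mpoly K[2]}, forall y, ev Q y = sqdist A y.
Proof.
exists (('X_(0 : 'I_2) - A.1%:MP) ^+ 2 + ('X_(1 : 'I_2) - A.2%:MP) ^+ 2) => y.
by rewrite !expr2 evD !evM !evB !evX !evC.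
Qed.

(** Once denominators are cleared, s^2 = q(y) absorbs the even powers of [s]. The polynomials E and
    O do not depend on the choice of root, so both roots can be compared. *)
Lemma ev_mv A d f : exists N E O, forall y s, s != 0 -> s ^+ 2 = sqdist A y ->
  s ^+ N * ev f (mv A (d / s) y) = ev E y + s * ev O y.
Proof.
have [Q evQ] := sqdist_polyP A; elim/mpoly2_ind: f => [c|i|f1 f2|f1 f2].
- by exists 0%N, c%:MP, 0%:MP => y s _ _; rewrite !evC; ring.
- exists 1%N, (d%:MP * ('X_i - (if val i == 0%N then A.1 else A.2)%:MP)), 'X_i => y s s0 _.
  by rewrite evM evB !evC !evX /mv /=; case: ifP => _; field.
- move=> [N1 [E1 [O1 IH1]]] [N2 [E2 [O2 IH2]]].
  (* Sums need the common exponent [N1 + N2], hence powers of [s] in the form E + s O. *)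
  have pow N : exists E O, forall y s, s ^+ 2 = sqdist A y -> s ^+ N = ev E y + s * ev O y.
    elim: N => [|N [E [O IH]]].
      by exists 1%:MP, 0%:MP => y s _; rewrite !evC mulr0 addr0.
    exists (Q * O), E => y s s2; rewrite exprS (IH y s s2) evM evQ -s2.
    by ring.
  have [E3 [O3 pow1]] := pow N1; have [E4 [O4 pow2]] := pow N2.
  exists (N1 + N2)%N, (E1 * E4 + Q * O1 * O4 + (E2 * E3 + Q * O2 * O3)),
    (E1 * O4 + O1 * E4 + (E2 * O3 + O2 * E3)) => y s s0 s2.
  set z := mv A _ y; have := IH1 y s s0 s2; have := IH2 y s s0 s2; rewrite -/z => F2 F1.
  transitivity (s ^+ N2 * (s ^+ N1 * ev f1 z) + s ^+ N1 * (s ^+ N2 * ev f2 z)).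
    by rewrite evD exprD; ring.
  rewrite F1 F2 (pow1 y s s2) (pow2 y s s2) !(evD, evM) evQ.
  by rewrite -s2; ring.
- move=> [N1 [E1 [O1 IH1]]] [N2 [E2 [O2 IH2]]].
  exists (N1 + N2)%N, (E1 * E2 + Q * O1 * O2), (E1 * O2 + O1 * E2) => y s s0 s2.
  rewrite !(evD, evM) evQ exprD mulrACA IH1 // IH2 // -s2.
  by ring.
Qed.

Lemma even_odd0 (E O s : K) : s != 0 -> E + s * O = 0 -> E + - s * O = 0 -> E = 0 /\ O = 0.
Proof.
move=> s0 Ep Em; have two0 := two_neq0 char0.
have /eqP : 2%:R * E = 0 by rewrite -[RHS](addr0 0) -{1}Ep -Em; ring.
rewrite mulf_eq0 (negPf two0) => /eqP E0; split=> //.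
by move/eqP: Ep; rewrite E0 add0r mulf_eq0 (negPf s0) => /eqP.
Qed.
End Conchoids.

(** * Branches of the conchoid *)

Section Branches.
Variables (K : closedFieldType) (g : {mpoly K[2]}) (A : pt K) (d : K).
Hypotheses (char0 : [pchar K] =i pred0) (g_irr : mirreducible g) (d0 : d != 0).
Hypothesis C0_ne : exists p, D0 (zeroset g) A p.
Hypothesis not_circle : ~ exists r : K, seteq (zeroset g) (circle A r).
Implicit Types (x y : pt K) (f h p : {mpoly K[2]}) (S M : pset K).

Local Notation C := (zeroset g).
Local Notation q := (sqdist A).

(** Being nonzero in the coordinate ring of the curve, so that [h] may serve as a denominator. *)
Definition nzC h := ~ forall y, C y -> ev h y = 0.

Lemma nzC_mul h1 h2 : nzC h1 -> nzC h2 -> nzC (h1 * h2).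
Proof.
move=> n1 n2 n12; have [|/n1 //|/n2 //] := zeroset_prime (f1 := h1) (f2 := h2) g_irr.
by move=> y /n12; rewrite evM.
Qed.

(** The coordinate ring is a domain; equivalently, the open set where [h] is nonzero is dense in the
    curve. *)
Lemma zeroset_cancel h f : nzC h -> (forall y, C y -> ev h y != 0 -> ev f y = 0) ->
  forall y, C y -> ev f y = 0.
Proof.
move=> nh hf; have [y Cy|/nh //|//] := zeroset_prime (f1 := h) (f2 := f) g_irr.
by have [->|/hf ->//] := eqVneq (ev h y) 0; rewrite (mul0r, mulr0).
Qed.

Lemma nzC_sqdist Q : (forall y, ev Q y = q y) -> nzC Q.
Proof. by move=> evQ Q0; have [y [/Q0 + /eqP]] := C0_ne; rewrite evQ. Qed.

Lemma nzC_circle Q (r : K) : (forall y, ev Q y = q y) -> r != 0 -> nzC (Q - (r ^+ 2)%:MP).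
Proof.
move=> evQ r0 Q0; apply: not_circle; exists r; apply: zeroset_sub_circle => // y /Q0.
by rewrite evB evC evQ => /eqP; rewrite subr_eq0 => /eqP.
Qed.

(** The relation [R] selects a sheet of the double cover s^2 = q, and [h] cuts out the open set of
    the curve over which it is taken. *)
Definition image_lifts h (R : pt K -> K -> Prop) : pset K := fun x =>
  exists y s, [/\ C y /\ ev h y != 0, s != 0, s ^+ 2 = q y, R y s & x = mv A (d / s) y].

(** A polynomial vanishing on the image has E + s O = 0 for both roots, so E = O = 0 on an open part
    of the curve and hence on all of it. *)
Lemma image_lifts_dense h : nzC h ->
  Defs.subset (fun x => exists y, fibre2 C A d x y)
    (zclosure (image_lifts h (fun _ _ => True))).
Proof.
move=> nh x [y /(fibre2P _ _ _ _ d0)[Cy [s [s0 s2 ->]]]] p p0.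
have [Q evQ] := sqdist_polyP A; have [N [E [O EO]]] := ev_mv A d p.
have EO0 y' : C y' -> ev (h * Q) y' != 0 -> ev E y' = 0 /\ ev O y' = 0.
  rewrite evM mulf_eq0 negb_or evQ => Cy' /andP[hy' qy'].
  have [t t2] := sqr_ex (q y').
  have t0 : t != 0 by apply: contraNneq qy' => t0; rewrite -t2 t0 expr0n.
  apply: (even_odd0 char0 t0).
    by rewrite -EO // p0 ?mulr0 //; exists y', t.
  rewrite -EO ?oppr_eq0 ?sqrrN // p0 ?mulr0 //; exists y', (- t).
  by rewrite oppr_eq0 sqrrN.
have nhQ := nzC_mul nh (nzC_sqdist evQ).
have Ey := zeroset_cancel nhQ (fun y Cy hy => (EO0 y Cy hy).1) Cy.
have Oy := zeroset_cancel nhQ (fun y Cy hy => (EO0 y Cy hy).2) Cy.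
have /eqP := EO y s s0 s2.
by rewrite Ey Oy mulr0 addr0 mulf_eq0 expf_eq0 (negPf s0) andbF => /eqP.
Qed.

(* [S] is a Zariski-irreducible part of the conchoid that dominates [C]. *)
Definition branch S :=
  [/\ forall x, S x -> exists y s,
        [/\ C y, s != 0, s ^+ 2 = q y, s + d != 0 & x = mv A (d / s) y],
      forall f1 f2, (forall x, S x -> ev f1 x * ev f2 x = 0) ->
        (forall x, S x -> ev f1 x = 0) \/ (forall x, S x -> ev f2 x = 0) &
      exists2 h, nzC h & forall y, C y -> ev h y != 0 -> exists s,
        [/\ s != 0, s ^+ 2 = q y, s + d != 0 & S (mv A (d / s) y)]].

(** For either root, q (q - d^2) = s^2 (s - d) (s + d). *)
Lemma avoid_centre Q y s : (forall y, ev Q y = q y) ->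
  ev (Q * (Q - (d ^+ 2)%:MP)) y != 0 -> s ^+ 2 = q y -> s != 0 /\ s + d != 0.
Proof.
move=> evQ; rewrite evM evB evC evQ => k0 s2; rewrite -s2 subr_sqr !mulf_eq0 !negb_or in k0.
by case/and3P: k0 => /andP[].
Qed.

(** Here s = E/O is a rational function on the curve. Each E' + s O' becomes (O E' + E O') / O, and
    irreducibility of the branch comes down to that of the curve. *)
Lemma branch_split Q E O : (forall y, ev Q y = q y) -> nzC O ->
  (forall y, C y -> ev E y ^+ 2 = q y * ev O y ^+ 2) ->
  branch (image_lifts (Q * (Q - (d ^+ 2)%:MP) * O) (fun y s => ev E y = s * ev O y)).
Proof.
move=> evQ nO E2; set k := Q * _.
have nkO : nzC (k * O).
  by apply: nzC_mul => //; apply: nzC_mul; [exact: nzC_sqdist | exact: nzC_circle].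
have lift y : C y -> ev (k * O) y != 0 -> exists s,
    [/\ s != 0, s ^+ 2 = q y, s + d != 0 & ev E y = s * ev O y].
  move=> Cy; rewrite evM mulf_eq0 negb_or => /andP[ky Oy].
  have s2 : (ev E y / ev O y) ^+ 2 = q y.
    by rewrite expr_div_n E2 // mulfK // expf_neq0.
  have [s0 r0] := avoid_centre evQ ky s2.
  by exists (ev E y / ev O y); split; rewrite ?divfK.
split.
- move=> x [y [s [[Cy]]]]; rewrite evM mulf_eq0 negb_or => /andP[ky _] s0 s2 _ ->.
  by exists y, s; have [_ r0] := avoid_centre evQ ky s2.
- move=> f1 f2 f12.
  have [N1 [E1 [O1 EO1]]] := ev_mv A d f1; have [N2 [E2' [O2 EO2]]] := ev_mv A d f2.
  have vanish f N E' O' : (forall y s, s != 0 -> s ^+ 2 = q y ->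
        s ^+ N * ev f (mv A (d / s) y) = ev E' y + s * ev O' y) ->
      (forall y, C y -> ev (O * E' + E * O') y = 0) ->
      forall x, image_lifts (k * O) (fun y s => ev E y = s * ev O y) x -> ev f x = 0.
    move=> EO' OE x [y [s [[Cy]]]]; rewrite evM mulf_eq0 negb_or => /andP[_ Oy] s0 s2 Es ->.
    have comb : ev (O * E' + E * O') y = ev O y * (ev E' y + s * ev O' y).
      by rewrite evD !evM Es; ring.
    have /eqP := OE y Cy; rewrite comb -EO' //.
    by rewrite !mulf_eq0 (negPf Oy) expf_eq0 (negPf s0) andbF => /eqP.
  have [|/(vanish _ _ _ _ EO1)|/(vanish _ _ _ _ EO2)] := zeroset_prime
    (f1 := O * E1 + E * O1) (f2 := O * E2' + E * O2) g_irr; [|by left|by right].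
  move=> y Cy; rewrite -evM; apply: (zeroset_cancel nkO) Cy => {}y Cy ky.
  have [s [s0 s2 _ Es]] := lift y Cy ky.
  have /f12/eqP : image_lifts (k * O) (fun y s => ev E y = s * ev O y) (mv A (d / s) y).
    by exists y, s.
  have comb E' O' : ev (O * E' + E * O') y = ev O y * (ev E' y + s * ev O' y).
    by rewrite evD !evM Es; ring.
  rewrite evM !comb -EO1 // -EO2 //.
  by rewrite mulf_eq0 => /orP[] /eqP ->; rewrite !(mulr0, mul0r).
- exists (k * O) => // y Cy ky; have [s [s0 s2 r0 Es]] := lift y Cy ky.
  by exists s; split=> //; exists y, s.
Qed.

(** The norm E^2 - q O^2 is multiplicative. As [q] is not a square, it vanishes on the curve only if
    E and O do, so irreducibility follows from that of the curve. *)
Lemma branch_nonsplit Q : (forall y, ev Q y = q y) ->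
  (forall E O, (forall y, C y -> ev E y ^+ 2 = q y * ev O y ^+ 2) ->
    forall y, C y -> ev O y = 0) ->
  branch (image_lifts (Q * (Q - (d ^+ 2)%:MP)) (fun _ _ => True)).
Proof.
move=> evQ sqE; set k := Q * _.
have nk : nzC k by apply: nzC_mul; [exact: nzC_sqdist | exact: nzC_circle].
have lift y : ev k y != 0 -> exists s, [/\ s != 0, s ^+ 2 = q y & s + d != 0].
  move=> ky; have [s s2] := sqr_ex (q y).
  by have [s0 r0] := avoid_centre evQ ky s2; exists s.
split.
- move=> x [y [s [[Cy ky] s0 s2 _ ->]]].
  by exists y, s; have [_ r0] := avoid_centre evQ ky s2.
- move=> f1 f2 f12.
  have [N1 [E1 [O1 EO1]]] := ev_mv A d f1; have [N2 [E2 [O2 EO2]]] := ev_mv A d f2.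
  have vanish f N E O : (forall y s, s != 0 -> s ^+ 2 = q y ->
        s ^+ N * ev f (mv A (d / s) y) = ev E y + s * ev O y) ->
      (forall y, C y -> ev (E * E - Q * (O * O)) y = 0) ->
      forall x, image_lifts k (fun _ _ => True) x -> ev f x = 0.
    move=> EO norm0 x [y [s [[Cy _] s0 s2 _ ->]]].
    have E2O z : C z -> ev E z ^+ 2 = q z * ev O z ^+ 2.
      by move=> /norm0/eqP; rewrite evB !evM evQ subr_eq0 !expr2 => /eqP.
    have Oy := sqE E O E2O y Cy; have := E2O y Cy; rewrite Oy expr0n mulr0 => /eqP.
    rewrite expf_eq0 /= => /eqP Ey; have := EO y s s0 s2; rewrite Ey Oy mulr0 addr0 => /eqP.
    by rewrite mulf_eq0 expf_eq0 (negPf s0) andbF => /eqP.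
  have [|/(vanish _ _ _ _ EO1)|/(vanish _ _ _ _ EO2)] := zeroset_prime
    (f1 := E1 * E1 - Q * (O1 * O1)) (f2 := E2 * E2 - Q * (O2 * O2)) g_irr; [|by left|by right].
  move=> y Cy; rewrite -evM; apply: (zeroset_cancel nk) Cy => {}y Cy ky.
  have [s [s0 s2 _]] := lift y ky.
  have /f12/eqP : image_lifts k (fun _ _ => True) (mv A (d / s) y) by exists y, s.
  have norm E O : ev (E * E - Q * (O * O)) y =
      (ev E y + s * ev O y) * (ev E y - s * ev O y).
    by rewrite evB !evM evQ -s2; ring.
  rewrite evM !norm -EO1 // -EO2 //.
  by rewrite mulf_eq0 => /orP[] /eqP ->; rewrite !(mulr0, mul0r).
- exists k => // y Cy ky; have [s [s0 s2 r0]] := lift y ky.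
  by exists s; split=> //; exists y, s.
Qed.

(* The double cover [s ^+ 2 = q y] of [C] splits exactly when [q] is a square
   in the function field of [C]. *)
Lemma branches : exists S1 S2, [/\ branch S1, branch S2 &
  Defs.subset (fun x => exists y, fibre2 C A d x y)
    (zclosure (fun x => S1 x \/ S2 x))].
Proof.
have [Q evQ] := sqdist_polyP A; pose k := Q * (Q - (d ^+ 2)%:MP).
have nk : nzC k by apply: nzC_mul; [exact: nzC_sqdist | exact: nzC_circle].
have [[E [O [nO E2]]]|nsq] := classic (exists E O, nzC O /\
    forall y, C y -> ev E y ^+ 2 = q y * ev O y ^+ 2); last first.
  have br : branch (image_lifts k (fun _ _ => True)).
    apply: branch_nonsplit => // E O E2; have [//|nO] := classic (forall y, C y -> ev O y = 0).
    by case: nsq; exists E, O.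
  (* The cover is irreducible here, and its single branch is listed twice. *)
  exists (image_lifts k (fun _ _ => True)), (image_lifts k (fun _ _ => True)); split=> //.
  move=> x /(image_lifts_dense nk); apply: zclosure_sub => {}x Sx.
  by apply: sub_zclosure; left.
have nkO := nzC_mul nk nO.
exists (image_lifts (k * O) (fun y s => ev E y = s * ev O y)),
  (image_lifts (k * O) (fun y s => ev (- E) y = s * ev O y)); split.
- exact: branch_split.
- by apply: branch_split => // y Cy; rewrite /ev mevalN sqrrN; apply: E2.
move=> x /(image_lifts_dense nkO); apply: zclosure_sub => {}x [y [s [[Cy ky] s0 s2 _ ->]]].
apply: sub_zclosure.
(* Every root [s] satisfies E = s O or E = - s O, hence lies on one of the two sheets. *)
have /eqP : (ev E y - s * ev O y) * (ev E y + s * ev O y) = 0.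
  by rewrite -subr_sqr exprMn E2 // s2 subrr.
rewrite mulf_eq0 subr_eq0 addr_eq0 => /orP[] /eqP Es; [left|right]; exists y, s; split=> //.
by rewrite /ev mevalN -/(ev E y) Es opprK.
Qed.

(** If the closure is not inside [Z1], some [f1] vanishes on [Z1] but not on S. For every [f2]
    vanishing on [Z2] the product vanishes on S, hence so does [f2]. *)
Lemma branch_zirreducible S : branch S -> zirreducible (zclosure S).
Proof.
case=> _ S_irr [h nh liftS]; split; first exact: zclosed_zclosure.
split.
  have [y [Cy /eqP hy]] := not_all_imp nh.
  by have [s [_ _ _ Sx]] := liftS y Cy hy; exists (mv A (d / s) y); apply: sub_zclosure.
move=> Z1 Z2 cl1 cl2 SZ.
have [|n1] := classic (Defs.subset (zclosure S) Z1); first by left.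
right=> x Sx; apply: cl2 => f2 f2Z2.
have [z [Sz Nz]] := not_all_imp n1.
have [f1 [f1Z1 f1z]] := not_all_imp (fun H => Nz (cl1 z H)).
have [x' Sx'|f1S|f2S] := S_irr f1 f2; [|by case: f1z; apply: Sz|exact: Sx].
have [/f1Z1->|/f2Z2->] := SZ x' (sub_zclosure Sx'); by rewrite (mul0r, mulr0).
Qed.

(** The closures of the two branches cover the conchoid, so the irreducible M lies in one of them,
    and maximality gives equality. *)
Lemma component_branch M : irr_component M (conchoid C A d) ->
  exists2 S, branch S & seteq (zclosure S) M.
Proof.
move=> [[M_cl [M_ne M_irr]] [MX M_max]]; have [S1 [S2 [br1 br2 cover]]] := branches.
have sub S : branch S -> Defs.subset M (zclosure S) -> seteq (zclosure S) M.
  move=> br MS; apply: M_max => //; first exact: branch_zirreducible.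
  apply: zclosure_sub => x Sx; have [toC _ _] := br.
  have [y [s [Cy s0 s2 _ ->]]] := toC x Sx.
  apply: sub_zclosure; exists y; apply/(fibre2P _ _ _ _ d0); split=> //; by exists s.
have [||x Mx|/(sub _ br1)|/(sub _ br2)] := M_irr (zclosure S1) (zclosure S2);
  [exact: zclosed_zclosure|exact: zclosed_zclosure| |by exists S1|by exists S2].
by apply: zclosureU; apply: (zclosure_sub cover); apply: MX.
Qed.
End Branches.

(** * Special components and the conchoid of a component *)

Theorem theorem2 (K : closedFieldType) (char0 : [pchar K] =i pred0)
  (g : {mpoly K[2]}) (g_irr : mirreducible g)
  (A : pt K) (d : K) (d_neq0 : d != 0)
  (C0_ne : exists p, D0 (zeroset g) A p)
  (not_circle : ~ exists r : K, seteq (zeroset g) (circle A r))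
  (M : pset K) (M_comp : irr_component M (conchoid (zeroset g) A d)) :
  special_comp (zeroset g) A d M <-> seteq (conchoid M A d) (zeroset g).
Proof.
have two0 := two_neq0 char0; have [Q evQ] := sqdist_polyP A.
have nQ := nzC_sqdist C0_ne evQ.
have nQr r : r != 0 -> nzC g (Q - (r ^+ 2)%:MP) by exact: (nzC_circle char0 g_irr not_circle evQ).
split=> [special|MC]; last first.
  move=> [Omega [OM [_ [OdM uniqO]]]].
  (* Where q (q - d^2) is nonzero, both points y + (d/r) (y - A) and y - (d/r) (y - A) are in the
     fibre. Uniqueness makes them equal, so y = A and q = 0. *)
  have OQ y : Omega y -> ev (Q * (Q - (d ^+ 2)%:MP)) y = 0.
    move=> Oy; have [z [_ z_uniq]] := uniqO y Oy; apply/eqP; apply: contraT => qy.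
    have fib r : r ^+ 2 = sqdist A y -> mv A (d / r) y = z.
      move=> r2; have [r0 rd] := avoid_centre evQ qy r2.
      apply: z_uniq; apply/(fibre2P _ _ _ _ d_neq0); split.
        apply/MC; apply: sub_zclosure; exists y.
        by apply/(fibre2P _ _ _ _ d_neq0); split; [exact: OM | exists r].
      exists (- (r + d)); rewrite oppr_eq0 sqrrN mvK // sqdist_mv //.
    have [r r2] := sqr_ex (sqdist A y); have [r0 _] := avoid_centre evQ qy r2.
    have := etrans (fib r r2) (esym (fib (- r) _)); rewrite sqrrN => /(_ r2).
    rewrite /mv => -[/addrI e1 /addrI e2]; move: qy; rewrite evM evQ.
    have half (t : K) : d / r * t = d / - r * t -> t = 0.
      move=> /eqP; rewrite -subr_eq0 invrN mulrN mulNr opprK -mulrDl.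
      rewrite -mulr2n -mulr_natl !mulf_eq0 invr_eq0 (negPf two0) (negPf d_neq0) (negPf r0).
      by move/eqP.
    by rewrite /sqdist (half _ e1) (half _ e2) expr0n addr0 mul0r eqxx.
  (* On M now q = 0 or q = d^2. A point with a lift has s = d or s = - d, and moving it gives q = (s
     + d)^2, that is 4 d^2 or 0. *)
  have CQ y : zeroset g y -> ev (Q * (Q - ((2%:R * d) ^+ 2)%:MP)) y = 0.
    move=> /MC; apply=> {}y [x [w Bxy]].
    have /(fibre2P _ _ _ _ d_neq0)[Mx [s [s0 s2 ->]]] : fibre2 M A d y x by exists w.
    have /eqP := (OdM x).2 Mx _ OQ.
    rewrite !evM !evB !evC !evQ sqdist_mv // -s2 mulf_eq0 expf_eq0 (negPf s0) /=.
    rewrite subr_sqr mulf_eq0 subr_eq0 addr_eq0 => /orP[] /eqP ->; ring.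
  by apply: (nzC_mul g_irr nQ (nQr _ _)) CQ; rewrite mulf_neq0.
have [S [toC S_irr [h nh liftS]] SM] := component_branch char0 g_irr d_neq0 C0_ne not_circle M_comp.
have [[M_cl [M_ne M_irr]] _] := M_comp.
pose uniq_fibre x := exists y, fibre2 (zeroset g) A d x y /\
  forall y', fibre2 (zeroset g) A d x y' -> y' = y.
have sub T : Defs.subset T S -> Defs.subset (zclosure T) M.
  by move=> TS x Tx; apply/SM; apply: zclosure_sub Tx => {}x /TS; apply: sub_zclosure.
(* By irreducibility, the points of S with a one-point fibre or the remaining ones are dense in M;
   the former would make M simple. *)
have [||||] := M_irr (zclosure (fun x => S x /\ uniq_fibre x))
  (zclosure (fun x => S x /\ ~ uniq_fibre x)); try exact: zclosed_zclosure.
- move=> x /SM Sx; apply: zclosureU; apply: zclosure_sub Sx => {}x Sx.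
  by apply: sub_zclosure; have [u|u] := classic (uniq_fibre x); [left|right].
- move=> dense1; case: special; exists (fun x => S x /\ uniq_fibre x); split.
    by move=> x [Sx _]; apply/SM; apply: sub_zclosure.
  split.
    (* The constant 1 shows that the closure of the empty set is empty, whereas M is not. *)
    apply: NNPP => none; have [x /dense1 Mx] := M_ne.
    have /eqP := Mx 1%:MP (fun y Sy => False_ind _ (none (ex_intro _ y Sy))).
    by rewrite evC oner_eq0.
  split=> [x|x []//]; split=> [|/dense1 //].
  by apply: sub => y [].
move=> dense2; have [N [E [O EO]]] := ev_mv A d g.
have EO0 x : S x -> ~ uniq_fibre x -> ev E x = 0 /\ ev O x = 0.
  move=> Sx nu; have [y [s [Cy s0 s2 r0 Dx]]] := toC x Sx.
  set r := s + d in r0; have r2 : r ^+ 2 = sqdist A x by rewrite Dx sqdist_mv.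
  have fib : fibre2 (zeroset g) A d x y.
    by apply/(fibre2P _ _ _ _ d_neq0); split=> //; exists s.
  have Dy : y = mv A (d / - r) x by rewrite Dx mvK.
  have [y' [fib' ny']] : exists y', fibre2 (zeroset g) A d x y' /\ y' <> y.
    by apply: not_all_imp => all_y; apply: nu; exists y.
  have [Cy' [s' [s'0 s'2 Dx']]] := (fibre2P _ _ _ _ d_neq0).1 fib'.
  have r'2 : (s' + d) ^+ 2 = r ^+ 2 by rewrite r2 Dx' sqdist_mv.
  (* The root r would give back [y], so the second point of the fibre comes from the opposite root;
     thus both candidates lie on the curve. *)
  have Dy' : y' = mv A (d / r) x.
    move/eqP: r'2; rewrite eqf_sqr => /orP[] /eqP r'E.
      by case: ny'; rewrite Dy -r'E Dx' mvK // r'E.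
    by rewrite -[r]opprK -r'E Dx' mvK // r'E oppr_eq0.
  apply: (even_odd0 char0 r0); first by rewrite -EO // -Dy' Cy' mulr0.
  by rewrite -EO ?oppr_eq0 ?sqrrN // -Dy Cy mulr0.
have EOM x : M x -> ev E x = 0 /\ ev O x = 0.
  by move=> /dense2 Mx; split; apply: Mx => y [Sy ny]; have [] := EO0 y Sy ny.
move=> y; split=> [|Cy p p0].
  move=> My; apply: (My g) => {My}y [x [w Bxy]].
  have /(fibre2P _ _ _ _ d_neq0)[Mx [s [s0 s2 ->]]] : fibre2 M A d y x by exists w.
  have [E0 O0] := EOM x Mx; have /eqP := EO x s s0 s2.
  by rewrite E0 O0 mulr0 addr0 mulf_eq0 expf_eq0 (negPf s0) andbF => /eqP.
(* It suffices to treat the points [y] that lift to S: the lift lies in M, and moving it with the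
   root -(s + d) returns [y]. *)
apply: (zeroset_cancel g_irr nh) Cy => {}y Cy hy; apply: p0.
have [s [s0 s2 r0 Sx]] := liftS y Cy hy; exists (mv A (d / s) y).
apply/(fibre2P _ _ _ _ d_neq0); split; first by apply/SM; apply: sub_zclosure.
by exists (- (s + d)); rewrite oppr_eq0 sqrrN mvK ?sqdist_mv.
Qed.
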